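(* Let $a<b$ be relatively prime positive integers, one of which is even, and let $\mathcal{U}=\mathcal{U}(a,b)$. Then: (i) if $a$ is even, the set of even positive integers in $\mathcal{U}\cap[0,ab]$ is exactly $\{a,\,a+2b,\,a+4b,\dots,a+(a-2)b\}$, and moreover $a+ab\in\mathcal{U}$; (ii) if $b$ is even, the set of even positive integers in $\mathcal{U}\cap[0,ab]$ is exactly $\{b,\,b+2a,\,b+4a,\dots,b+(b-2)a\}$, and moreover $b+ba\in\mathcal{U}$.
   Context: For positive integers $a<b$, the Ulam sequence $\mathcal{U}(a,b)$ has first terms $a,b$, and each subsequent term is the smallest integer larger than all previous terms that can be written as the sum of two distinct earlier terms in exactly one way (unordered pairs). The sequence is identified with its set of terms.
   Formalization: In (ii) the interval [0,ab] is replaced by [0,max(ab, b+(b-2)a)], since for b>2a the last listed element exceeds ab and the literal claim fails (e.g. U(1,4): even terms in [0,4] are {4}, but the list is {4,6}); for b≤2a nothing changes. *)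

(* Defs.v *)
From mathcomp Require Import all_boot zify.

Set Implicit Arguments.
Unset Strict Implicit.
Unset Printing Implicit Defensive.

(* Number of ways of writing n as a sum of two distinct terms among
   u 0, ..., u (k - 1).  An unordered pair of terms is encoded by its pair of
   indices i < j: the terms of an Ulam sequence at distinct indices are
   distinct. *)
Definition num_reps (u : nat -> nat) (k n : nat) : nat :=
  #|[set p : 'I_k * 'I_k | (p.1 < p.2) && (u p.1 + u p.2 == n)]|.

Definition ulam_candidate (u : nat -> nat) (k n : nat) : Prop :=
  (forall i, i < k -> u i < n) /\ num_reps u k n = 1.

(* u enumerates U(a, b), from index 0. *)
Definition is_ulam (a b : nat) (u : nat -> nat) : Prop :=
  [/\ u 0 = a, u 1 = b &
      forall k, 1 < k ->
        ulam_candidate u k (u k) /\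
        (forall n, ulam_candidate u k n -> u k <= n)].

Definition ulam_term (u : nat -> nat) (n : nat) : Prop := exists k, u k = n.

(* For 0 < a < b the sequence is well defined: there is exactly one u with
   is_ulam a b u.  A next term always exists because the sum of the two
   largest terms so far is a candidate. *)

Lemma eq_num_reps u v k n :
  (forall i, i < k -> u i = v i) -> num_reps u k n = num_reps v k n.
Proof. by move=> uv; apply: eq_card => -[i j]; rewrite !inE /= !uv. Qed.

Lemma eq_ulam_candidate u v k n : (forall i, i < k -> u i = v i) ->
  ulam_candidate u k n -> ulam_candidate v k n.
Proof.
move=> uv [lt_n rep1]; split; last by rewrite -(eq_num_reps n uv).
by move=> i ik; rewrite -uv // lt_n.
Qed.

Lemma is_ulam_unique a b u v : is_ulam a b u -> is_ulam a b v -> u =1 v.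
Proof.
move=> [u0 u1 uS] [v0 v1 vS]; elim/ltn_ind => -[|[|k]] IH; rewrite ?u0 ?u1 //.
have [uc um] := uS k.+2 isT; have [vc vm] := vS k.+2 isT.
apply/eqP; rewrite eqn_leq um ?vm //; first exact: eq_ulam_candidate uc.
by apply: eq_ulam_candidate vc => i /IH.
Qed.

Lemma num_reps_top u k : (forall i j, i < j -> j < k.+2 -> u i < u j) ->
  num_reps u k.+2 (u k + u k.+1) = 1.
Proof.
move=> inc; have kk : k < k.+2 by lia.
apply/eqP/cards1P; exists (Ordinal kk, ord_max).
apply/setP => -[[i ik] [j jk]]; rewrite !inE xpair_eqE -!val_eqE /=.
apply/andP/andP => [[ij /eqP E]|[/eqP -> /eqP ->]]; last by split; [lia|].
have lej : u j <= u k.+1.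
  by case: (ltngtP j k.+1) => [jk1||->//]; [apply/ltnW/inc|lia].
have lei : u i <= u k.
  by case: (ltngtP i k) => [ik1||->//]; [apply/ltnW/inc|lia].
have [jk1|jk1] := ltnP j k.+1; first by have := inc _ _ jk1 (ltnSn _); lia.
have [ik1|ik1] := ltnP i k; last by split; apply/eqP; lia.
by have := inc _ _ ik1 kk; lia.
Qed.

Definition ulam_next (u : nat -> nat) (k : nat) : nat :=
  find (fun n => all (fun i => u i < n) (iota 0 k) && (num_reps u k n == 1))
       (iota 0 (u k.-2 + u k.-1).+1).

Lemma ulam_nextP u k : 0 < u 0 -> (forall i j, i < j -> j < k.+2 -> u i < u j) ->
  ulam_candidate u k.+2 (ulam_next u k.+2) /\
  (forall n, ulam_candidate u k.+2 n -> ulam_next u k.+2 <= n).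
Proof.
move=> u0 inc; rewrite /ulam_next.
set P := (fun n => _ && _); set N := (_ + _).+1.
have PP n : reflect (ulam_candidate u k.+2 n) (P n).
  apply: (iffP andP) => -[A B]; split; try exact/eqP.
    by move=> i ik; apply: (allP A); rewrite mem_iota.
  by apply/allP => i; rewrite mem_iota => /A.
have hasP0 : has P (iota 0 N).
  apply/hasP; exists (u k + u k.+1); first by rewrite mem_iota /N /=; lia.
  apply/PP; split; last exact: num_reps_top.
  have ub i : i < k.+2 -> u 0 <= u i.
    by case: i => [//|i] ik; apply/ltnW/inc.
  move=> i ik; have k0 : 0 < u k by have := ub k; lia.
  have [->|ne] := eqVneq i k.+1; first by lia.
  by have : u i < u k.+1 by [apply: inc; lia]; lia.
have fN : find P (iota 0 N) < N by rewrite -[X in _ < X](size_iota 0) -has_find.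
split; first by apply/PP; have := nth_find 0 hasP0; rewrite nth_iota.
move=> n /PP Pn; rewrite leqNgt; apply/negP => lt_n.
by have := before_find 0 lt_n; rewrite nth_iota ?Pn //; lia.
Qed.

Fixpoint ulam_prefix (a b k : nat) : nat -> nat :=
  if k is k'.+1 then
    fun i => if i == k'.+2 then ulam_next (ulam_prefix a b k') k'.+2
             else ulam_prefix a b k' i
  else fun i => if i == 0 then a else b.

Lemma is_ulam_exists a b : 0 < a -> a < b -> exists u, is_ulam a b u.
Proof.
move=> a0 ab; pose F := ulam_prefix a b; pose u i := F i i.
have FE k i : i <= k.+1 -> F k i = u i.
  elim: k i => [|k IH] i; first by case: i => [|[|i]].
  rewrite /F /= -/(F k) leq_eqVlt => /predU1P[->|ik].
    by rewrite eqxx /u /F /= eqn_leq ltnn andbF /= eqxx.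
  by rewrite ifN ?IH //; lia.
have uS k : u k.+2 = ulam_next (F k) k.+2.
  by rewrite -(FE k.+1) // /F /= eqxx.
have step k : (forall i j, i < j -> j < k.+2 -> u i < u j) ->
    ulam_candidate u k.+2 (u k.+2) /\
    (forall n, ulam_candidate u k.+2 n -> u k.+2 <= n).
  move=> inc; have [|i j ij jk|c m] := @ulam_nextP (F k) k.
  - by rewrite FE.
  - by rewrite !FE ?inc //; lia.
  rewrite uS; split; first by apply: eq_ulam_candidate c => i ik; rewrite FE.
  by move=> n cn; apply: m; apply: eq_ulam_candidate cn => i ik; rewrite FE.
have inc k : forall i j, i < j -> j < k.+2 -> u i < u j.
  elim: k => [|k IH] i j ij; first by case: j i ij => [|[|j]] // [|i].
  rewrite ltnS leq_eqVlt => /predU1P[jk|]; last exact: IH.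
  by subst j; have [[lt_ _] _] := step k IH; apply: lt_.
exists u; split=> // -[|[|k]] // _; exact/step/inc.
Qed.

(* Main.v *)
Require Import Defs.
From mathcomp Require Import all_boot zify.

Set Implicit Arguments.
Unset Strict Implicit.
Unset Printing Implicit Defensive.

(** Write the terms as [x a + y b]. Up to [a b + b] no two relevant pairs
    [(x, y)] give the same integer, so the sequence coincides there with the
    Ulam set of the free lattice generated by [(1, 0)] and [(0, 1)], which
    consists of the pairs with [x = 1], with [y = 1], or with [x] and [y] both
    odd. Parity of [x a + y b] then forces [x = 1] when [a] is even, and
    [y = 1] when [b] is even. *)

(** * Representations as sums, and the lattice model *)

Definition is_rep (P : nat -> Prop) (n s t : nat) : Prop :=
  [/\ s < t, P s, P t & s + t = n].

Definition unique_rep (P : nat -> Prop) (n : nat) : Prop :=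
  exists s t, is_rep P n s t /\
    forall s' t', is_rep P n s' t' -> s' = s /\ t' = t.

Definition lattice_ulam (p : nat * nat) : bool :=
  [|| p.1 == 1, p.2 == 1 | odd p.1 && odd p.2].

(** Splits are ordered, since the lattice carries no order matching the integers: each decomposition
    occurs twice, with summands swapped. *)
Definition is_split (p q r : nat * nat) : Prop :=
  [/\ lattice_ulam q, lattice_ulam r, q <> r, p.1 = q.1 + r.1
    & p.2 = q.2 + r.2].

Definition lattice_val (a b : nat) (p : nat * nat) : nat := p.1 * a + p.2 * b.

(** * The sequence as a set determined by unique representations *)

Lemma ulam_mono a b u : a < b -> is_ulam a b u ->
  forall i j, i < j -> u i < u j.
Proof.
move=> ab [u0 u1 uS] i [|[|j]] // ij; first by case: i ij => //; rewrite u0 u1.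
by have [[lt_ _] _] := uS j.+2 isT; apply: lt_.
Qed.

(** Let [k] be the first index with [n <= u k]. Terms are positive, so both summands of [n] lie
    below [n], hence among the first [k] terms, and [num_reps u k n] counts all representations. If
    it is 1, [n] is a candidate at step [k], and minimality of [u k] gives [u k = n]. *)
Lemma ulam_term_unique_rep a b u n : 0 < a -> a < b -> is_ulam a b u -> b < n ->
  ulam_term u n <-> unique_rep (ulam_term u) n.
Proof.
move=> a0 ab Hu bn; have mono := ulam_mono ab Hu; have [u0 u1 uS] := Hu.
have lei i : i <= u i.
  by elim: i => // i IH; have := mono i i.+1 (ltnSn i); lia.
have exk : exists k, n <= u k by exists n.
case: (ex_minnP exk) => k nk kmin.
have ltk i : i < k -> u i < n.
  by move=> ik; rewrite ltnNge; apply/negP => /kmin; lia.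
have gtk i : u i < n -> i < k.
  move=> in_; rewrite ltnNge; apply/negP; rewrite leq_eqVlt => /predU1P[ki|/mono].
    by subst; lia.
  lia.
have k2 : 1 < k by apply: gtk; rewrite u1.
have [[_ ck] mk] := uS k k2.
have pos i : 0 < u i by case: i => [|i]; [lia|have := mono 0 i.+1 isT; lia].
have rep1 : num_reps u k n = 1 <-> unique_rep (ulam_term u) n.
  split.
    move/eqP/cards1P => -[[i j]] /setP E.
    have := E (i, j); rewrite !inE eqxx /= => /andP[ij /eqP uij].
    exists (u i), (u j); split; first by split=> //; [exact: mono|exists i|exists j].
    move=> s t [st [i' ui] [j' uj] eqn]; subst s t.
    have i'k : i' < k by apply: gtk; have := pos j'; lia.
    have j'k : j' < k by apply: gtk; have := pos i'; lia.
    have i'j' : i' < j'.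
      rewrite ltnNge; apply/negP; rewrite leq_eqVlt => /predU1P[e|/mono]; last by lia.
      by subst; lia.
    have := E (Ordinal i'k, Ordinal j'k); rewrite !inE /= i'j' eqn eqxx /=.
    by move/esym/eqP => [<- <-].
  move=> [s [t [[st [i ui] [j uj] eqn] uniq]]].
  have ik : i < k by apply: gtk; have := pos j; lia.
  have jk : j < k by apply: gtk; have := pos i; lia.
  have inj i1 i2 : u i1 = u i2 -> i1 = i2.
    by move=> e; case: (ltngtP i1 i2) => // /mono; lia.
  have ij : i < j.
    rewrite ltnNge; apply/negP; rewrite leq_eqVlt => /predU1P[e|/mono]; last by lia.
    by subst; lia.
  apply/eqP/cards1P; exists (Ordinal ik, Ordinal jk).
  apply/setP => -[[i' i'k] [j' j'k]]; rewrite !inE xpair_eqE -!val_eqE /=.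
  apply/andP/andP => [[i'j' /eqP e]|[/eqP -> /eqP ->]]; last first.
    by split; [|rewrite ui uj eqn].
  have [|e1 e2] := uniq (u i') (u j').
    by split=> //; [exact: mono|exists i'|exists j'].
  by split; apply/eqP; apply: inj; rewrite ?ui ?uj.
rewrite -rep1; split.
  move=> [i ui]; suff -> : n = u k by [].
  have [ik|ki] := ltnP i k; first by have := ltk i ik; lia.
  by case: (ltngtP k i) ki => // [/mono|->]; lia.
by move=> e; exists k; apply/eqP; rewrite eqn_leq nk mk.
Qed.

Lemma ulam_term_le a b u n : a < b -> is_ulam a b u -> n <= b ->
  ulam_term u n <-> n = a \/ n = b.
Proof.
move=> ab Hu nb; have mono := ulam_mono ab Hu; have [u0 u1 _] := Hu.
split; last by case=> ->; [exists 0|exists 1].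
by move=> [[|[|i]] ui]; [left; lia|right; lia|have := mono 1 i.+2 isT; lia].
Qed.

(** * Decompositions in the lattice *)

Lemma lattice_ulam_split p : lattice_ulam p -> 1 < p.1 + p.2 ->
  exists q r, is_split p q r /\
    forall q' r', is_split p q' r' -> (q', r') = (q, r) \/ (q', r') = (r, q).
Proof.
rewrite /is_split /lattice_ulam; case: p => x y /= Fp xy.
have [x1|nx1] := eqVneq x 1.
  (* One summand has first coordinate 0, and [(0, 1)] is the only such point of [lattice_ulam]. *)
  exists (1, y.-1), (0, 1); split; first by split=> //=; lia.
  by move=> [x1' y1] [x2 y2] /= [F1 F2 _ ex ey];
    have [e|e] : x1' = 0 \/ x2 = 0 by [lia| |]; [right|left]; do 2!congr pair; lia.
have [y1|ny1] := eqVneq y 1.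
  exists (x.-1, 1), (1, 0); split; first by split=> //=; lia.
  by move=> [x1' y1'] [x2 y2] /= [F1 F2 _ ex ey];
    have [e|e] : y1' = 0 \/ y2 = 0 by [lia| |]; [right|left]; do 2!congr pair; lia.
(* Both coordinates are odd, so one summand has even first coordinate, hence second coordinate 1.
   The other then has even second coordinate, hence first coordinate 1. *)
exists (1, y.-1), (x.-1, 1); split; first by split=> //=; [lia|case|lia|lia]; lia.
move=> [x1 y1'] [x2 y2] /= [F1 F2 _ ex ey].
have [e|e] : odd x1 \/ odd x2 by [lia| |]; [left|right]; do 2!congr pair; lia.
Qed.

(** A split forces both coordinates above 1: points of [lattice_ulam] on an axis are generators, and
    a generator may not be added to itself. Two decompositions are then exhibited by parity, with
    separate witnesses when an even coordinate equals 2. The two inequalities make them differ as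
    unordered pairs. *)
Lemma non_lattice_ulam_split p q r : ~~ lattice_ulam p -> is_split p q r ->
  exists q1 r1 q2 r2, [/\ is_split p q1 r1, is_split p q2 r2, q2 <> q1 & q2 <> r1].
Proof.
rewrite /is_split /lattice_ulam; case: p q r => [x y] [x1 y1] [x2 y2] /=.
move=> nF [F1 F2 ne ex ey].
have x_gt1 : 1 < x.
  by rewrite ltnNge; apply/negP => x1'; apply: ne; congr pair; lia.
have y_gt1 : 1 < y.
  by rewrite ltnNge; apply/negP => y1'; apply: ne; congr pair; lia.
have [oy|ey'] := boolP (odd y).
  exists (1, 0), (x.-1, y), (1, 2), (x.-1, y - 2).
  by split; [split=> //=|split=> //=| |]; try (case; lia); lia.
have [ox|ex'] := boolP (odd x).
  exists (0, 1), (x, y.-1), (2, 1), (x - 2, y.-1).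
  by split; [split=> //=|split=> //=| |]; try (case; lia); lia.
have [x_eq2|nx2] := eqVneq x 2.
  have [y_eq2|ny2] := eqVneq y 2.
    exists (1, 0), (1, 2), (0, 1), (2, 1).
    by split; [split=> //=|split=> //=| |]; try (case; lia); lia.
  exists (1, 0), (1, y), (1, 1), (1, y.-1).
  by split; [split=> //=|split=> //=| |]; try (case; lia); lia.
have [y_eq2|ny2] := eqVneq y 2.
  exists (0, 1), (x, 1), (1, 1), (x.-1, 1).
  by split; [split=> //=|split=> //=| |]; try (case; lia); lia.
exists (1, 1), (x.-1, y.-1), (1, y.-1), (x.-1, 1).
by split; [split=> //=|split=> //=| |]; try (case; lia); lia.
Qed.

(** * Injectivity of the evaluation *)

(* On these pairs the only possible collision, of [(0, y)] with
   [(b, y - a)], is excluded. *)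
Definition in_range (b : nat) (p : nat * nat) : Prop :=
  [/\ p.1 <= b, p.1 = b -> 0 < p.2 & p.1 = 0 -> p.2 <= 1].

Lemma lattice_val_inj a b p q : 0 < a -> 0 < b -> coprime a b ->
  in_range b p -> in_range b q -> lattice_val a b p = lattice_val a b q -> p = q.
Proof.
move=> a0 b0 co; wlog le_pq : p q / p.1 <= q.1.
  move=> H rp rq e; case: (leqP p.1 q.1) => [l|/ltnW l]; first exact: H.
  by apply/esym/H.
case: p q le_pq => [x y] [x' y'] /= lexx [xb xb' x0] [xb2 xb2' x02].
rewrite /lattice_val /= in xb xb' x0 xb2 xb2' x02 * => e.
have e2 : (x' - x) * a = (y - y') * b by rewrite !mulnBl; nia.
have : b %| x' - x by rewrite -(@Gauss_dvdl _ _ a) ?e2 ?dvdn_mull // coprime_sym.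
(* As [x' - x <= b], the quotient is 0 or 1; quotient 1 is the collision of [(0, y)] with
   [(b, y - a)]. *)
case/dvdnP => -[|[|m]] em; [| |nia].
  have xx : x' = x by lia.
  have yy : y' = y by apply/eqP; rewrite -(eqn_pmul2r b0); move: e; rewrite xx; lia.
  by rewrite xx yy.
have xx : x' = b by lia.
have xx0 : x = 0 by lia.
have := x0 xx0; have := xb2' xx; nia.
Qed.

(** This is the source of the bound [a * b + b]: a first coordinate above [b] forces a positive
    second one, so the value is at least [(b + 1) * a + b]. *)
Lemma in_range_lattice_ulam a b p : 0 < a -> 1 < b -> lattice_ulam p ->
  lattice_val a b p <= a * b + b -> in_range b p.
Proof.
rewrite /lattice_ulam /lattice_val; case: p => x y /= a0 b1 Fp le_.
split=> /=; [|lia|lia].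
rewrite leqNgt; apply/negP => bx; have y_gt0 : 0 < y by lia.
by have := leq_mul bx (leqnn a); have := leq_mul y_gt0 (leqnn b); lia.
Qed.

Lemma in_range_split a b p q r : 0 < a -> 1 < b -> is_split p q r ->
  lattice_val a b p <= a * b + b -> in_range b p.
Proof.
rewrite /is_split /lattice_ulam /lattice_val.
case: p q r => [x y] [x1 y1] [x2 y2] /= a0 b1 [F1 F2 ne ex ey] le_.
have ypos : 0 < y by rewrite lt0n; apply/eqP => y0; apply: ne; congr pair; lia.
have xpos : 0 < x by rewrite lt0n; apply/eqP => x0; apply: ne; congr pair; lia.
split=> /=; [|lia|lia].
rewrite leqNgt; apply/negP => bx.
by have := leq_mul bx (leqnn a); have := leq_mul ypos (leqnn b); lia.
Qed.

Lemma lattice_ulam_val_inj a b p q : 0 < a -> 1 < b -> coprime a b ->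
  lattice_ulam p -> lattice_ulam q -> lattice_val a b p <= a * b + b ->
  lattice_val a b p = lattice_val a b q -> p = q.
Proof.
move=> a0 b1 co Fp Fq le_ e; apply: (lattice_val_inj a0 _ co _ _ e); first by lia.
  exact: in_range_lattice_ulam le_.
by apply: (in_range_lattice_ulam a0) => //; rewrite -e.
Qed.

Lemma lattice_val_split a b p q r : is_split p q r ->
  lattice_val a b p = lattice_val a b q + lattice_val a b r.
Proof. by rewrite /lattice_val => -[_ _ _ -> ->]; lia. Qed.

Lemma lattice_val_gt0 a b p : 0 < a -> 0 < b -> lattice_ulam p ->
  0 < lattice_val a b p.
Proof. by rewrite /lattice_val /lattice_ulam; case: p => x y /= *; nia. Qed.

(** * Transfer to the sequence, and its even terms *)

(** By strong induction the terms below [n] are lattice values, so representations of [n] come from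
    splits of points of value [n], and conversely. Injectivity keeps distinct decompositions
    distinct, so uniqueness passes between the two sides. *)
Lemma ulam_term_lattice a b u n : 0 < a -> a < b -> coprime a b -> is_ulam a b u ->
  n <= a * b + b ->
  ulam_term u n <-> exists2 p, lattice_ulam p & n = lattice_val a b p.
Proof.
move=> a0 ab co Hu; have b1 : 1 < b by lia.
have b0 : 0 < b by lia.
have vpos := fun p => @lattice_val_gt0 a b p a0 b0.
elim/ltn_ind: n => n IH le_n.
have [nb|bn] := leqP n b.
  rewrite (ulam_term_le ab Hu nb); split.
    by case=> ->; [exists (1, 0)|exists (0, 1)] => //; rewrite /lattice_val /=; lia.
  move=> [[x y] Fp e]; rewrite /lattice_val /lattice_ulam /= in Fp e.
  case: y Fp e => [|[|y]] /= Fp e; [left|right|]; try nia.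
rewrite (ulam_term_unique_rep a0 ab Hu bn).
have upos m : ulam_term u m -> 0 < m.
  have [u0 _ _] := Hu; move=> [[|i] <-]; first by rewrite u0.
  by have := ulam_mono ab Hu (ltn0Sn i); lia.
have rep_split s t : is_rep (ulam_term u) n s t -> exists p q r,
    [/\ is_split p q r, lattice_val a b p = n, lattice_val a b q = s
      & lattice_val a b r = t].
  move=> [st us ut e].
  have [q Fq eq_] : exists2 p, lattice_ulam p & s = lattice_val a b p.
    by apply/IH => //; have := upos _ ut; lia.
  have [r Fr er] : exists2 p, lattice_ulam p & t = lattice_val a b p.
    by apply/IH => //; have := upos _ us; lia.
  exists (q.1 + r.1, q.2 + r.2), q, r; split=> //.
    by split=> // e2; subst; lia.
  by rewrite -e eq_ er /lattice_val /=; lia.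
have split_rep p q r : is_split p q r -> lattice_val a b p = n ->
    let: (s, t) := (lattice_val a b q, lattice_val a b r) in
    is_rep (ulam_term u) n (minn s t) (maxn s t).
  move=> sp e; have e2 := lattice_val_split a b sp; have [Fq Fr ne _ _] := sp.
  have nev : lattice_val a b q <> lattice_val a b r.
    by move=> ev; apply: ne; apply: (lattice_ulam_val_inj a0 b1 co) => //; lia.
  have pq := vpos _ Fq; have pr := vpos _ Fr.
  have uq : ulam_term u (lattice_val a b q) by apply/IH; [lia|lia|exists q].
  have ur : ulam_term u (lattice_val a b r) by apply/IH; [lia|lia|exists r].
  by case: (ltngtP (lattice_val a b q) (lattice_val a b r)) => h; split=> //; lia.
split.
  move=> [s [t [rep uniq]]].
  have [p [q [r [sp ep _ _]]]] := rep_split _ _ rep.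
  have [Fp|nFp] := boolP (lattice_ulam p); first by exists p.
  have [q1 [r1 [q2 [r2 [s1 s2 ne1 ne2]]]]] := non_lattice_ulam_split nFp sp.
  have [m1 M1] := uniq _ _ (split_rep _ _ _ s1 ep).
  have [m2 M2] := uniq _ _ (split_rep _ _ _ s2 ep).
  have ev1 := lattice_val_split a b s1; have ev2 := lattice_val_split a b s2.
  have [Fq1 Fr1 _ _ _] := s1; have [Fq2 Fr2 _ _ _] := s2.
  (* Both splits yield the same minimum and maximum. *)
  have [e|e] : lattice_val a b q2 = lattice_val a b q1 \/
               lattice_val a b q2 = lattice_val a b r1 by lia.
    by case: ne1; apply: (lattice_ulam_val_inj a0 b1 co) => //; lia.
  by case: ne2; apply: (lattice_ulam_val_inj a0 b1 co) => //; lia.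
move=> [p Fp ep].
have p2 : 1 < p.1 + p.2.
  rewrite ltnNge; apply/negP => p1; move: Fp bn; rewrite ep /lattice_val.
  by case: p p1 {ep} => [[|[|x]] [|[|y]]] //=; lia.
have [q [r [sp uniq]]] := lattice_ulam_split Fp p2.
have e2 := lattice_val_split a b sp.
exists (minn (lattice_val a b q) (lattice_val a b r)),
       (maxn (lattice_val a b q) (lattice_val a b r)).
split; first exact: (split_rep _ _ _ sp (esym ep)).
move=> s t rep; have [p' [q' [r' [sp' ep' es et]]]] := rep_split _ _ rep.
(* [p'] is not known to lie in [lattice_ulam]; its range bound comes from its having a split. *)
have pp : p' = p.
  apply: (lattice_val_inj a0 b0 co); last by rewrite ep'.
    by apply: (in_range_split a0 b1 sp'); rewrite ep'.
  by apply: (in_range_lattice_ulam a0 b1 Fp); rewrite -ep.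
have [st _ _ _] := rep.
by rewrite pp in sp'; case: (uniq _ _ sp') => -[e3 e4]; subst q' r'; lia.
Qed.

Theorem theorem5p11 (a b : nat) (u : nat -> nat)
  (a_gt0 : 0 < a) (lt_ab : a < b) (co_ab : coprime a b)
  (even_ab : ~~ odd a \/ ~~ odd b) (Hu : is_ulam a b u) :
  (~~ odd a ->
     (forall n : nat,
        [/\ ulam_term u n, 0 < n, ~~ odd n & n <= a * b] <->
        exists j : nat, 2 * j <= a - 2 /\ n = a + 2 * j * b) /\
     ulam_term u (a + a * b)) /\
  (~~ odd b ->
     (forall n : nat,
        [/\ ulam_term u n, 0 < n, ~~ odd n &
            n <= maxn (a * b) (b + (b - 2) * a)] <->
        exists j : nat, 2 * j <= b - 2 /\ n = b + 2 * j * a) /\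
     ulam_term u (b + b * a)).
Proof.
have char n := @ulam_term_lattice a b u n a_gt0 lt_ab co_ab Hu.
have not_both : odd a || odd b.
  apply/negPn/negP; rewrite negb_or -!dvdn2 => /andP[da db].
  by have := dvdn_gcd 2 a b; rewrite da db (eqP co_ab).
split=> [ea|eb].
  have ob : odd b by rewrite (negPf ea) in not_both.
  split; last first.
    apply/char; first by lia.
    (* The value exceeds [a * b] but stays below [a * b + b] because [a < b]. *)
    by exists (1, a) => //; rewrite /lattice_val /= mul1n.
  move=> n; split.
    move=> [un n0 en le_n]; have [|[x y] Fp e] := (char n _).1 un; first by lia.
    rewrite /lattice_ulam /lattice_val /= in Fp e.
    have ey : ~~ odd y.
      by move: en; rewrite e oddD !oddM (negPf ea) ob andbF andbT.
    have x1 : x = 1 by lia.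
    have ya : y < a by rewrite ltnNge; apply/negP => ay; nia.
    by exists y./2; rewrite e x1; split; [lia|congr (_ + _ * _); lia].
  move=> [j [ja ->]].
  have le_n : a + 2 * j * b <= a * b by nia.
  split=> //; [|lia|by rewrite oddD !oddM /= addbF].
  apply/char; first by lia.
  by exists (1, 2 * j) => //; rewrite /lattice_val /= mul1n.
have oa : odd a by rewrite (negPf eb) orbF in not_both.
split; last first.
  apply/char; first by lia.
  (* This value attains the bound [a * b + b] exactly. *)
  by exists (b, 1) => //=; rewrite /lattice_val /lattice_ulam /= ?orbT //; lia.
(* The last listed term is [a * b + b - 2 * a], which passes [a * b] once [b > 2 * a] but stays in
   the range of the lattice description. *)
have le_max : maxn (a * b) (b + (b - 2) * a) <= a * b + b by rewrite geq_max; nia.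
move=> n; split.
  move=> [un n0 en le_n]; have [|[x y] Fp e] := (char n _).1 un; first by lia.
  rewrite /lattice_ulam /lattice_val /= in Fp e.
  have ex : ~~ odd x.
    by move: en; rewrite e oddD !oddM (negPf eb) oa andbF andbT addbF.
  have y1 : y = 1 by lia.
  have xb : x <= b - 2.
    (* [x] and [b] are both even, so [x > b - 2] gives [x >= b], and the value is at least
       [a * b + b]. *)
    rewrite leqNgt; apply/negP => bx; have xb1 : b <= x by lia.
    have := leq_mul xb1 (leqnn a).
    by move: le_n; rewrite e y1 leq_max mulnBl => /orP[]; lia.
  by exists x./2; split; [lia|rewrite e y1 mul1n addnC; congr (_ + _ * _); lia].
move=> [j [jb ->]].
have le_n : b + 2 * j * a <= b + (b - 2) * a by rewrite leq_add2l leq_mul2r jb orbT.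
split; [|lia|by rewrite oddD !oddM /= addbF|lia].
apply/char; first by lia.
by exists (2 * j, 1); rewrite /lattice_val /lattice_ulam /= ?orbT // mul1n addnC.
Qed.
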